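(* (i) For every $t\in T_{hyp}\mathbb{Z}$, $$\sum_{n\in\mathbb{N}}|a_n|^2 e^{-it\frac{2\pi(n-n_0)}{T_{hyp}}}=1 .$$ (ii) For every $\varepsilon>0$ with $\varepsilon<1-\gamma'$, and for $t\in\mathbb{R}$ such that $\operatorname{dist}\left(t/T_{hyp},\mathbb{Z}\right)>|\ln h|^{\gamma'-1+\varepsilon}$, $$\sum_{n\in\mathbb{N}}|a_n|^2 e^{-it\frac{2\pi(n-n_0)}{T_{hyp}}}=O\left(|\ln h|^{-\infty}\right)\quad\text{as } h\to0^+ .$$
   Context: Potential and spectral functions. Let $V\in C^\infty(\mathbb{R})$ be real-valued, bounded below, with $V(x)\to+\infty$ as $|x|\to\infty$, having exactly one local maximum, which is non-degenerate and located at $0$, with $V(0)=V'(0)=0$, $V''(0)<0$; let $P_h=-\frac{h^2}{2}\frac{d^2}{dx^2}+V$, $h>0$ small. The singular Bohr-Sommerfeld theory of Colin de Verdière and Parisse attaches to $P_h$ near energy $0$ real-valued smooth functions $\varepsilon,S^+,S^-$ on an interval $[-\delta,\delta]$ ($\delta>0$ independent of $h$), depending on $h$, with asymptotic expansions as $h\to0^+$ (uniform on $[-\delta,\delta]$ together with all $E$-derivatives) $\varepsilon(E)=\sum_{j\ge0}\varepsilon_j(E)h^j$, $S^{\pm}(E)=\sum_{j\ge0}S_j^{\pm}(E)h^j$, with smooth $h$-independent coefficients, $\varepsilon_0(0)=0$, $\varepsilon_0'(0)=1/\sqrt{-V''(0)}$. Put $\theta_\pm=S^\pm/h$ and, for $\lambda\in[-1,1]$,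 $f_h(\lambda)=F_h(\lambda h)$, $g_h(\lambda)=G_h(\lambda h)$, where $F_h(E)=-\frac{\theta_+(E)+\theta_-(E)}{2}+\frac{\pi}{2}+\frac{\varepsilon(E)}{h}\ln h+\arg\Gamma\left(\frac12+i\frac{\varepsilon(E)}{h}\right)$ (with $\arg\Gamma=\mathrm{Im}\ln\Gamma$ the continuous determination) and $G_h(E)=\frac{\theta_+(E)-\theta_-(E)}{2}$. Let $\mathcal{Y}_h(\lambda)=f_h(\lambda)-\arccos\left(\frac{\cos g_h(\lambda)}{\sqrt{1+\exp(2\pi\varepsilon(\lambda h)/h)}}\right)$, $\lambda\in[-1,1]$. It is known that for $h$ small $\mathcal{Y}_h$ is a bijection of $[-1,1]$ onto its image and $\mathcal{Y}_h'(\lambda)=\frac{\ln h}{\sqrt{-V''(0)}}+O(1)$ uniformly on $[-1,1]$. Let $\mathcal{A}_h=\mathcal{Y}_h^{-1}:\mathcal{Y}_h([-1,1])\to[-1,1]$ (smooth) and $\mathbf{I}_h=\{k\in\mathbb{Z}: 2\pi k\in\mathcal{Y}_h([-1,1])\}$. Initial state. Fix $E\in[-1,1]$ and let $n_0=n_0(h,E)$ be the (assumed unique) minimizer over $n\in\mathbf{I}_h$ of $|h\mathcal{A}_h(2\pi n)-hE|$; one has $n_0\sim N/h$ as $h\to0^+$ for a constant $N>0$. Fix $\chi\in\mathcal{S}(\mathbb{R})$ not identically zero, non-negative and even, and $0\le\gamma'<1$. Put $a_n=K_h\,\chi\left(\frac{n-n_0}{|\ln h|^{1-\gamma'}}\right)$,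 $n\in\mathbb{Z}$, where $K_h>0$ is the normalizing constant $K_h=\left\|\chi\left(\frac{\cdot-n_0}{|\ln h|^{1-\gamma'}}\right)\right\|_{\ell^2(\mathbb{N})}^{-1}$. Hyperbolic period: $T_{hyp}=1/\mathcal{A}_h'(2\pi n_0)$. Conventions: $O(|\ln h|^{-\infty})$ means $O(|\ln h|^{-M})$ as $h\to0^+$ for every $M\ge1$, with constants independent of $t$; $\operatorname{dist}(x,\mathbb{Z})=\min_{\ell\in\mathbb{Z}}|x-\ell|$. *)

(* Defs.v *)
From HB Require Import structures.
From mathcomp Require Import all_boot all_order all_algebra complex.
From mathcomp Require Import all_classical all_reals all_analysis.
Set Implicit Arguments.
Unset Strict Implicit.
Unset Printing Implicit Defensive.
Import Order.TTheory GRing.Theory Num.Theory numFieldNormedType.Exports.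
Local Open Scope ring_scope.
Local Open Scope complex_scope.
Local Open Scope classical_set_scope.

Section Defs.
Context {R : realType}.
Implicit Types (D : set R) (f : R -> R) (h x : R).

(* Differentiation relative to a set, so that functions on a closed interval
   have (one-sided) derivatives at its endpoints. *)
Definition diff_quotient f x : R -> R := fun y => (f y - f x) / (y - x).

Definition derive_within D f : R -> R :=
  fun x => lim (diff_quotient f x y @[y --> within D x^']).

Definition smooth_on D f := forall (k : nat) x, D x ->
  cvg (diff_quotient (iter k (derive_within D) f) x y @[y --> within D x^']).

Definition smooth f := forall (k : nat) x, derivable (derive1n k f) x 1.

Definition schwartz f := smooth f /\
  forall j k : nat, exists C : R, forall x, `|x ^+ j * derive1n k f x| <= C.

Definition local_max f x := \forall y \near x, f y <= f x.

Definition single_barrier (V : R -> R) :=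
  [/\ smooth V,
      exists m : R, forall x, m <= V x,
      V x @[x --> +oo] --> +oo /\ V x @[x --> -oo] --> +oo,
      forall x, local_max V x <-> x = 0 &
      [/\ V 0 = 0, derive1 V 0 = 0 & derive1n 2 V 0 < 0]].

(* [f h] is a family of smooth functions on [-delta, delta] with
   f h ~ \sum_j (f_ j) h^j as h -> 0+, uniformly together with all
   derivatives. *)
Definition semiclassical_expansion (delta : R) (f : R -> R -> R)
    (f_ : nat -> R -> R) :=
  let I := `[- delta, delta]%classic in
  [/\ \forall h \near 0^'+, smooth_on I (f h),
      forall j, smooth_on I (f_ j) &
      forall k J : nat, exists C : R, \forall h \near 0^'+, forall E, I E ->
        `| iter k (derive_within I) (f h) E
           - \sum_(j < J) iter k (derive_within I) (f_ j) E * h ^+ j |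
        <= C * h ^+ J].

Definition expi x : R[i] := cos x +i* sin x.

(* Euler's integral on the half-plane Re z > 0, with
   t^(z-1) = t^(Re z - 1) * exp(i * Im z * ln t). *)
Definition Gamma (z : R[i]) : R[i] :=
  let w t := t `^ (complex.Re z - 1) * expR (- t) in
  (\int[lebesgue_measure]_(t in `]0, +oo[) (w t * cos (complex.Im z * ln t)))%R
  +i*
  (\int[lebesgue_measure]_(t in `]0, +oo[) (w t * sin (complex.Im z * ln t)))%R.

(* x |-> arg Gamma(1/2 + i x): the continuous determination that vanishes at
   x = 0, where Gamma(1/2) > 0. *)
Definition argGamma_half : R -> R :=
  get [set a : R -> R | [/\ continuous a, a 0 = 0 &
    forall x, Gamma (2^-1 +i* x) = `|Gamma (2^-1 +i* x)| * expi (a x)]].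

Section SpectralFunctions.
Variables (eps Sp Sm : R -> R -> R) (h : R).

Definition theta_plus (E : R) := Sp h E / h.
Definition theta_minus (E : R) := Sm h E / h.

Definition bigF (E : R) :=
  - ((theta_plus E + theta_minus E) / 2) + pi / 2
  + eps h E / h * ln h + argGamma_half (eps h E / h).

Definition bigG (E : R) := (theta_plus E - theta_minus E) / 2.

Definition calY (lambda : R) :=
  bigF (lambda * h)
  - acos (cos (bigG (lambda * h))
          / Num.sqrt (1 + expR (2 * pi * eps h (lambda * h) / h))).

Definition calY_image : set R := calY @` `[-1, 1].

Definition calA (y : R) : R := get [set l | l \in `[-1, 1] /\ calY l = y].

Definition indexI : set int := [set k | calY_image (2 * pi * k%:~R)].

Definition is_unique_minimizer (E : R) (n0 : int) :=
  let d (n : int) := `|h * calA (2 * pi * n%:~R) - h * E| in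
  indexI n0 /\ forall n, indexI n -> n != n0 -> d n0 < d n.

Definition T_hyp (n0 : int) : R :=
  (derive_within calY_image calA (2 * pi * n0%:~R))^-1.

End SpectralFunctions.

Section InitialState.
Variables (chi : R -> R) (gamma' h : R) (n0 : int).

Definition l2_norm (u : nat -> R) : R :=
  Num.sqrt (limn (series (fun n => `|u n| ^+ 2))).

Definition profile (n : int) : R :=
  chi ((n - n0)%:~R / `|ln h| `^ (1 - gamma')).

Definition K_norm : R := (l2_norm (fun n : nat => profile n%:Z))^-1.

Definition coef (n : int) : R := K_norm * profile n.

(* The n-th term of the series, at time t and for period T. *)
Definition autocorr_term (T t : R) (n : nat) : R[i]^o :=
  (`|coef n%:Z| ^+ 2)%:C
  * expi (- (t * (2 * pi * (n%:Z - n0)%:~R / T))).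

End InitialState.

Definition dist_int x : R := inf [set `|x - l%:~R| | l in [set: int]].

End Defs.

(* Main.v *)
Require Import Defs.
From HB Require Import structures.
From mathcomp Require Import all_boot all_order all_algebra complex.
From mathcomp Require Import all_classical all_reals all_analysis.
From mathcomp Require Import ring lra.
Import Order.TTheory GRing.Theory Num.Theory numFieldNormedType.Exports.

(** Write [tau = t / T] for the time in units of the hyperbolic period, [L] for the
    width [|ln h| ^ (1 - gamma')] of the packet and [z = exp (- 2 i pi tau)]. Up to
    a phase, the autocorrelation is [K^2] times the sum of [w ((n - n0) / L) z^n]
    over [n >= 0], with [w = chi^2].

    If [tau] is an integer then [z = 1], and the sum is the squared norm of the
    normalized sequence, that is 1 ([autocorr_recurrence]). The normalization is
    meaningful for small [h] because the lattice of step [1 / L] then has a point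
    where [chi] is bounded below; this also bounds [K] ([sample_ge]).

    If [tau] is away from the integers, the sum oscillates and is estimated by
    summing by parts [k] times ([iter_summation_by_parts]). Each step divides by
    [1 - z], whose modulus is at least [dist (tau, Z)] ([dist_int_le_chord]), and
    replaces the samples by their finite differences, which gains a factor [1 / L]
    since [w] is smooth with decaying derivatives ([iter_fdiff_le]). As about [L]
    samples matter ([sum_lorentz]), the result is of order [L (L dist (tau, Z)) ^ - k], which is
    at most [L |ln h| ^ (- k epsilon)]: smaller than any given power of [|ln h|]
    once [k] is large. Summation starts at [n = 0] rather than at minus infinity,
    which leaves boundary terms at 0; there the argument of [w] is [- n0 / L],
    with [n0 ~ N / h] and [L <= |ln h|], so quadratic decay makes them of order
    [h ^ 2] up to powers of [|ln h|]. Both contributions are collected in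
    [trigonometric_sum_le]. *)

Set Implicit Arguments.
Unset Strict Implicit.
Unset Printing Implicit Defensive.
Local Open Scope ring_scope.
Local Open Scope complex_scope.
Local Open Scope classical_set_scope.

(** * The Lorentzian weight *)

Section Lorentzian.
Context {R : realType}.
Implicit Types (x y a s : R).

Definition lorentz x : R := (1 + x ^+ 2)^-1.

Lemma lorentz_gt0 x : 0 < lorentz x.
Proof. by rewrite invr_gt0; nra. Qed.

Lemma lorentz_le1 x : lorentz x <= 1.
Proof. by rewrite invf_le1; nra. Qed.

(** The weight varies by a bounded factor over a unit distance, so a value at the
    unknown point given by the mean value theorem can be traded for one at an
    end of the step. *)
Lemma lorentz_le_near x y : `|x - y| <= 1 -> lorentz x <= 3 * lorentz y.
Proof.
rewrite ler_norml => xy; rewrite /lorentz.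
have y1 : 1 + y ^+ 2 <= 3 * (1 + x ^+ 2).
  have := sqr_ge0 (x + (x - y)).
  have : (x - y) ^+ 2 <= 1 by nra.
  by move: xy => _; nra.
have p t : 0 < 1 + t ^+ 2 :> R by nra.
by rewrite -[leLHS]mul1r ler_pdivrMr// mulrAC ler_pdivlMr ?p// mul1r.
Qed.

Lemma lorentz_le_far x y : y ^+ 2 <= x ^+ 2 -> lorentz x <= lorentz y.
Proof. by move=> yx; rewrite /lorentz lef_pV2 ?posrE; nra. Qed.

Lemma lorentz_le_sqrV x : x != 0 -> lorentz x <= x ^- 2.
Proof.
move=> x0; have : 0 < x ^+ 2 by rewrite exprn_even_gt0 //.
by move=> ?; rewrite /lorentz lef_pV2 ?posrE; nra.
Qed.

Lemma MVT_shift (f df : R -> R) s x : 0 < s ->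
    (forall y, is_derive y 1 f (df y)) ->
  exists y, `|x - y| <= s /\ f (x + s) - f x = df y * s.
Proof.
move=> s0 fdf; have xs : x < x + s by rewrite ltrDl.
have cf : {within `[x, x + s], continuous f}.
  apply: derivable_within_continuous => y _.
  exact: (@ex_derive _ _ _ _ _ _ _ (fdf y)).
have [c] := MVT xs (fun y _ => fdf y) cf.
rewrite in_itv/= => /andP[xc cs]; rewrite addrAC subrr add0r => ->.
by exists c; split => //; rewrite ler_norml; lra.
Qed.

(** The weight is the derivative of atan, hence each sample is at most
    [3 / s] times an increment of atan over one step, and the sum telescopes:
    a Riemann-sum bound, uniform in the offset [a]. *)
Lemma sum_lorentz a s (J : nat) : 0 < s <= 1 ->
  \sum_(n < J) lorentz (a + n%:R * s) <= 3 * pi / s.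
Proof.
move=> /andP[s0 s1].
have step x : lorentz x <= 3 / s * (atan (x + s) - atan x).
  have [y [xy ->]] := MVT_shift x s0 (@is_derive1_atan R).
  have := lorentz_le_near (le_trans xy s1).
  by rewrite (mulrC _ s) mulrA divfK ?gt_eqF.
have tele : \sum_(n < J) lorentz (a + n%:R * s) <=
    3 / s * (atan (a + J%:R * s) - atan a).
  elim: J => [|J IH]; first by rewrite big_ord0 mul0r addr0 subrr mulr0.
  rewrite big_ord_recr /=; apply: le_trans (lerD IH (step _)) _.
  have -> : a + J.+1%:R * s = a + J%:R * s + s by rewrite -natr1; ring.
  by rewrite -mulrDr addrC subrKA.
apply: (le_trans tele); rewrite mulrAC.
rewrite ler_pM2r ?invr_gt0// ler_pM2l//.
have := atan_ltpi2 (a + J%:R * s); have := atan_gtNpi2 a; lra.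
Qed.

End Lorentzian.

(** * Finite differences of functions with quadratic decay *)

Section QuadraticDecay.
Context {R : realType}.
Implicit Types (f g : R -> R) (k : nat) (s x : R).

(** The part of the Schwartz condition that the argument consumes: [k]
    derivatives, each dominated by the Lorentzian. Giving the derivatives by
    existence rather than by a derivative operator makes stability under
    products a plain induction with the Leibniz rule. *)
Fixpoint quad_decay k f : Prop :=
  (exists C, forall x, `|f x| <= C * lorentz x) /\
  if k is k'.+1 then
    exists2 g, (forall x, is_derive x 1 f (g x)) & quad_decay k' g
  else True.

Lemma quad_decay_bound k f :
  quad_decay k f -> exists2 C, 0 <= C & forall x, `|f x| <= C * lorentz x.
Proof.
have H : (exists C, forall x, `|f x| <= C * lorentz x) ->
    exists2 C, 0 <= C & forall x, `|f x| <= C * lorentz x.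
  move=> [C fC]; exists C => //.
  by rewrite -(pmulr_lge0 C (lorentz_gt0 0)) (le_trans _ (fC 0)).
by case: k => [|k] [/H].
Qed.

Lemma quad_decayW k f : quad_decay k.+1 f -> quad_decay k f.
Proof.
by elim: k f => [|k IH] f [fC [g fg gk]]; split => //; exists g; last exact: IH.
Qed.

Lemma quad_decayD k f g :
  quad_decay k f -> quad_decay k g -> quad_decay k (f \+ g).
Proof.
have bound j h l : quad_decay j h -> quad_decay j l ->
    exists C, forall x, `|(h \+ l) x| <= C * lorentz x.
  move=> /quad_decay_bound[C _ hC] /quad_decay_bound[D _ lD].
  by exists (C + D) => x; rewrite mulrDl (le_trans (ler_normD _ _))// lerD.
elim: k f g => [|k IH] f g fk gk; (split; first exact: bound fk gk) => //.
have [_ [f' ff' f'k]] := fk; have [_ [g' gg' g'k]] := gk.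
by exists (f' \+ g'); [move=> x; exact: is_deriveD|exact: IH].
Qed.

Lemma quad_decayM k f g :
  quad_decay k f -> quad_decay k g -> quad_decay k (f \* g).
Proof.
have bound j h l : quad_decay j h -> quad_decay j l ->
    exists C, forall x, `|(h \* l) x| <= C * lorentz x.
  move=> /quad_decay_bound[C C0 hC] /quad_decay_bound[D D0 lD].
  exists (C * D) => x; rewrite normrM -mulrA; have := lorentz_le1 x.
  have := hC x; have := lD x; have := lorentz_gt0 x.
  move=> p0 lx hx p1; apply: le_trans (ler_pM _ _ hx lx) _ => //.
  have DL : D * lorentz x <= D by rewrite -[leRHS]mulr1 ler_wpM2l.
  by rewrite -mulrA ler_wpM2l// mulrCA ler_wpM2l// ler_piMr// ltW.
elim: k f g => [|k IH] f g fk gk; (split; first exact: bound fk gk) => //.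
have [_ [f' ff' f'k]] := fk; have [_ [g' gg' g'k]] := gk.
exists ((f \* g') \+ (g \* f')); first by move=> x; exact: is_deriveM.
by apply: quad_decayD; apply: IH => //; exact: quad_decayW.
Qed.

Lemma schwartz_quad_decay f k : schwartz f -> quad_decay k f.
Proof.
move=> [fsmooth fdecay]; rewrite -[f]/(derive1n 0 f).
have bound j : exists C, forall x, `|derive1n j f x| <= C * lorentz x.
  have [A hA] := fdecay 0%N j; have [B hB] := fdecay 2%N j.
  exists (A + B) => x; rewrite /lorentz ler_pdivlMr; last by nra.
  move: (hA x) (hB x); rewrite expr0 mul1r normrM ger0_norm ?sqr_ge0//; nra.
elim: k (0%N) => [|k IH] j; split => //.
exists (derive1n j.+1 f) => // x; rewrite derive1nS derive1E.
exact/derivableP.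
Qed.

Definition fdiff s f x : R := f (x + s) - f x.

Lemma is_derive_fdiff s f g : (forall x, is_derive x 1 f (g x)) ->
  forall x, is_derive x 1 (fdiff s f) (fdiff s g x).
Proof.
move=> fg x; apply: is_deriveB.
have shift1 : is_derive x 1 (fun y => y + s) (1 : R).
  by have := is_deriveD (is_derive_id x 1) (is_derive_cst s x 1); rewrite addr0.
by have := @is_derive1_comp _ f (fun y => y + s) x _ _ (fg (x + s)) shift1; rewrite mulr1.
Qed.

(** A finite difference commutes with differentiation, so by the mean value
    theorem the [k+1]-st difference of [f] is [s] times the [k]-th difference of
    [f'] at a point at distance at most [s]: each difference gains a factor [s]
    while keeping the decay. *)
Lemma iter_fdiff_le k f : quad_decay k f ->
  exists2 C, 0 <= C & forall s x, 0 < s <= 1 ->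
    `|iter k (fdiff s) f x| <= C * s ^+ k * lorentz x.
Proof.
elim: k f => [|k IH] f fk.
  have [C C0 fC] := quad_decay_bound fk.
  by exists C => // s x _; rewrite expr0 mulr1.
have [_ [g fg /IH[C C0 gC]]] := fk; exists (3 * C); first by rewrite mulr_ge0.
move=> s x /[dup] s01 /andP[s0 s1].
have itder j (y : R) : is_derive y 1 (iter j (fdiff s) f) (iter j (fdiff s) g y).
  by elim: j y => [|j IHj] y //=; exact: is_derive_fdiff.
rewrite /= /fdiff; have [y [xy ->]] := MVT_shift x s0 (itder k).
rewrite normrM (ger0_norm (ltW s0)) exprSr.
apply: le_trans (ler_wpM2r (ltW s0) (gC s y s01)) _.
have -> : 3 * C * (s ^+ k * s) * lorentz x = C * s ^+ k * (3 * lorentz x) * s by ring.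
rewrite ler_pM2r// ler_wpM2l ?mulr_ge0 ?exprn_ge0 ?(ltW s0)//.
by apply: lorentz_le_near; rewrite distrC; exact: le_trans xy s1.
Qed.

Lemma iter_fdiff_le_uniform k f : quad_decay k f ->
  exists2 C, 0 <= C & forall j s x, (j <= k)%N -> 0 < s <= 1 ->
    `|iter j (fdiff s) f x| <= C * s ^+ j * lorentz x.
Proof.
elim: k => [|k IH] fk.
  have [C C0 fC] := iter_fdiff_le fk.
  by exists C => // j s x; rewrite leqn0 => /eqP ->; exact: fC.
have [C C0 fC] := IH (quad_decayW fk); have [D D0 fD] := iter_fdiff_le fk.
exists (C + D); first exact: addr_ge0.
move=> j s x jk /[dup] s01 /andP[s0 _]; rewrite !mulrDl.
have p0 : 0 <= s ^+ j * lorentz x by rewrite mulr_ge0 ?exprn_ge0 ?ltW ?lorentz_gt0.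
move: jk; rewrite leq_eqVlt => /predU1P[jk|jk].
  by rewrite -jk in fD *; rewrite (le_trans (fD s x s01))// lerDr -mulrA mulr_ge0.
by rewrite (le_trans (fC j s x jk s01))// lerDl -mulrA mulr_ge0.
Qed.

End QuadraticDecay.

(** * Iterated summation by parts *)

Section SummationByParts.
Context {F : numFieldType}.
Implicit Types (u : nat -> F) (z : F) (J k : nat).

Definition delta u n : F := u n.+1 - u n.

Lemma summation_by_parts u z J :
  (1 - z) * \sum_(n < J) u n * z ^+ n =
  u 0%N - u J * z ^+ J + z * \sum_(n < J) delta u n * z ^+ n.
Proof.
elim: J => [|J IH]; first by rewrite !big_ord0 expr0; ring.
by rewrite !big_ord_recr /= !mulrDr IH /delta exprS; ring.
Qed.

(** Each summation by parts replaces [u] by its difference and divides by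
    [1 - z], leaving a boundary term at each end. For smooth slowly varying [u]
    this is the discrete counterpart of non-stationary phase. *)
Lemma iter_summation_by_parts k u z J : `|z| = 1 -> z != 1 ->
  `|\sum_(n < J) u n * z ^+ n| <=
  \sum_(j < k) (`|iter j delta u 0%N| + `|iter j delta u J|) / `|1 - z| ^+ j.+1
  + (\sum_(n < J) `|iter k delta u n|) / `|1 - z| ^+ k.
Proof.
move=> z1 zn1; have d0 : 0 < `|1 - z| by rewrite normr_gt0 subr_eq0 eq_sym.
elim: k u => [|k IH] u.
  rewrite big_ord0 add0r expr0 divr1 (le_trans (ler_norm_sum _ _ _))//.
  by apply: ler_sum => n _; rewrite normrM normrX z1 expr1n mulr1.
rewrite big_ord_recl /= expr1.
have -> : \sum_(n < J) u n * z ^+ n =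
    (u 0%N - u J * z ^+ J + z * \sum_(n < J) delta u n * z ^+ n) / (1 - z).
  by rewrite -summation_by_parts mulrC mulKf// subr_eq0 eq_sym.
rewrite normrM normfV ler_pdivrMr//.
have zz v : `|v * z ^+ J| = `|v| by rewrite normrM normrX z1 expr1n mulr1.
apply: (le_trans (ler_normD _ _)); rewrite normrM z1 mul1r.
apply: le_trans (lerD (ler_normB _ _) (IH (delta u))) _; rewrite zz.
rewrite [leRHS]mulrDl [X in _ <= X + _]mulrDl divfK ?gt_eqF//.
rewrite -[leRHS]addrA lerD2l.
rewrite -iterSr !exprSr invfM mulrA divfK ?gt_eqF// lerD2r mulr_suml.
apply: ler_sum => j _; rewrite -!iterSr [in leRHS]exprSr invfM mulrA.
by rewrite divfK ?gt_eqF.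
Qed.

End SummationByParts.

(** * The unit circle *)

Section ComplexExponential.
Context {R : realType}.
Implicit Types (x y : R) (z : R[i]).

Lemma expiD x y : expi (x + y) = expi x * expi y.
Proof.
by rewrite /expi cosD sinD (addrC (sin x * cos y)).
Qed.

Lemma expi0 : expi (0 : R) = 1.
Proof. by rewrite /expi cos0 sin0. Qed.

Lemma expiMn x (n : nat) : expi (n%:R * x) = expi x ^+ n.
Proof.
by elim: n => [|n IH]; rewrite ?mul0r ?expi0// -natr1 mulrDl mul1r expiD IH exprSr.
Qed.

Lemma norm_expi x : `|expi x| = 1.
Proof. by rewrite normc_def /= cos2Dsin2 sqrtr1. Qed.

Lemma expi_2piz (l : int) : expi (2 * pi * l%:~R : R) = 1.
Proof.
have e1 : expi (2 * pi : R) = 1.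
  by rewrite /expi mulr_natl cos2pi sin2pi.
case: l => n; first by rewrite mulrC expiMn e1 expr1n.
have : expi (2 * pi * (Negz n)%:~R : R) * expi (2 * pi * n.+1%:R) = 1.
  by rewrite -expiD NegzE mulrNz mulrN addNr expi0.
by rewrite [X in _ * expi X]mulrC expiMn e1 expr1n mulr1.
Qed.

(** A weak form of Jordan's inequality: sin x = 2 sin(x/2) cos(x/2), where
    sin(x/2) >= (x/2) cos(x/2) by the mean value theorem and
    2 cos(x/2)^2 = 1 + cos x >= 1. *)
Lemma half_le_sin x : 0 <= x <= pi / 2 -> x / 2 <= sin x.
Proof.
move=> /andP[x0 xpi]; have [->|xn0] := eqVneq x 0; first by rewrite mul0r sin0.
have {xn0} x0' : 0 < x by rewrite lt_neqAle eq_sym xn0.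
set y := x / 2; have y0 : 0 < y by rewrite divr_gt0.
have yp : y <= pi / 4 by rewrite /y; lra.
have pi0 := pi_gt0 R.
have csin : {within `[0, y], continuous (@sin R)}.
  by apply: continuous_subspaceT; exact: continuous_sin.
have [c] := MVT y0 (fun t _ => is_derive_sin t) csin.
rewrite in_itv/= sin0 !subr0 => /andP[c0 cy] siny.
have cosyc : cos y <= cos c.
  by rewrite leNgt ltr_cos ?in_itv/=; [rewrite -leNgt ltW|lra|lra].
have cosy2 : 2^-1 <= cos y ^+ 2.
  have : 0 <= cos (y *+ 2) by apply: cos_ge0_pihalf; rewrite -mulr_natr /y; lra.
  by rewrite cos_mulr2n -mulr_natr; lra.
have cosy0 : 0 <= cos y by apply: cos_ge0_pihalf; lra.
have -> : sin x = 2 * (cos y * (cos c * y)).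
  have -> : sin x = sin (y *+ 2) by congr sin; rewrite /y -mulr_natr divfK.
  by rewrite sin_mulr2n siny mulr_natl.
have : y * cos y ^+ 2 <= y * (cos y * cos c) by rewrite ler_pM2l// expr2 ler_wpM2l.
have : y * 2^-1 <= y * cos y ^+ 2 by rewrite ler_pM2l.
by rewrite -/y => ? ?; lra.
Qed.

Lemma dist_int_le x (l : int) : dist_int x <= `|x - l%:~R|.
Proof. by apply: ge_inf; [exists 0 => _ [m _ <-]|exists l]. Qed.

(** The chord from 1 to the point of angle [2 pi r] has length
    [2 |sin (pi r)|], to be applied to the remainder [r] of [x] modulo its
    nearest integer, for which [pi |r| <= pi / 2]. *)
Lemma dist_int_le_chord x : (dist_int x)%:C <= `|1 - expi (- (2 * pi * x))|.
Proof.
pose l := Num.floor (x + 2^-1); pose r := x - l%:~R.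
have r2 : `|r| <= 2^-1.
  have := floor_le (x + 2^-1); have := floorD1_gt (x + 2^-1).
  by rewrite intrD ler_norml /r -/l; lra.
have -> : expi (- (2 * pi * x)) = expi (- (2 * pi * r)).
  by rewrite /r mulrBr opprB expiD expi_2piz mul1r.
have pi0 := pi_gt0 R; have pi2 : 2 <= pi :> R by exact: pi_ge2.
have : `|r| <= 2 * sin (pi * `|r|).
  have /half_le_sin : 0 <= pi * `|r| <= pi / 2.
    by rewrite mulr_ge0 ?normr_ge0 ?(ltW pi0)//= ler_pM2l.
  have := ler_wpM2r (normr_ge0 r) pi2; have := normr_ge0 r; lra.
move=> rsin; apply: (@le_trans _ _ (`|r|)%:C); first by rewrite lecR dist_int_le.
rewrite normc_def lecR /=.
apply: (le_trans rsin); rewrite -[leLHS]ger0_norm ?(le_trans _ rsin)// -sqrtr_sqr.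
rewrite ler_sqrt ?addr_ge0 ?sqr_ge0//.
rewrite sub0r sqrrN sin2cos2 cosN.
have -> : cos (2 * pi * r) = 1 - 2 * sin (pi * `|r|) ^+ 2.
  have -> : cos (2 * pi * r) = cos ((pi * `|r|) *+ 2).
    have [r0|r0] := ger0P r; last rewrite -cosN.
      by congr cos; ring.
    by congr cos; ring.
  by rewrite cos_mulr2n cos2sin2 -mulr_natr; lra.
lra.
Qed.

End ComplexExponential.

(** * Series of complex numbers *)

Section ComplexSeries.
Context {R : realType}.

Lemma cvg_complex (x y : nat -> R) (a b : R) :
  x @ \oo --> a -> y @ \oo --> b ->
  (fun n => x n +i* y n : R[i]^o) @ \oo --> (a +i* b : R[i]^o).
Proof.
move=> xa yb; apply/cvgrPdist_lt => -[e e'] /[!ltcE]/= /andP[/eqP -> e0].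
have e20 : 0 < e / 2 by rewrite divr_gt0.
move/cvgrPdist_lt : xa => /(_ _ e20) xa; move/cvgrPdist_lt : yb => /(_ _ e20) yb.
near=> n.
have xan : `|a - x n| < e / 2 by near: n.
have ybn : `|b - y n| < e / 2 by near: n.
have -> : (a +i* b - (x n +i* y n) : R[i]) = (a - x n) +i* (b - y n) by [].
rewrite normc_def ltcR /= -[e]ger0_norm ?(ltW e0)// -sqrtr_sqr ltr_sqrt ?exprn_gt0//.
have sqr_lt t : `|t| < e / 2 -> t ^+ 2 < e ^+ 2 / 4.
  by rewrite ltr_norml => /andP[? ?]; nra.
by have := sqr_lt _ xan; have := sqr_lt _ ybn; have := exprn_gt0 2 e0; lra.
Unshelve. all: by end_near. Qed.

Lemma series_complexE (c d : nat -> R) :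
  series (fun n => c n +i* d n : R[i]^o) =
  (fun n => series c n +i* series d n : R[i]^o).
Proof.
apply/funext => n; rewrite /series /=; elim: n => [|n IH].
  by rewrite !big_geq.
by rewrite !big_nat_recr //= IH.
Qed.

(** Absolute convergence, checked on real and imaginary parts. *)
Lemma cvg_series_expi (c theta : nat -> R) :
  cvgn (series (fun n => `|c n|)) ->
  cvgn (series (fun n => (c n)%:C * expi (theta n) : R[i]^o)).
Proof.
move=> cc.
have sub (v : nat -> R) : (forall n, `|v n| <= 1) -> cvgn (series (fun n => c n * v n)).
  move=> v1; apply: normed_cvg; apply: series_le_cvg cc => n /=; rewrite ?normr_ge0//.
  by rewrite normrM ler_piMr.
have -> : (fun n => (c n)%:C * expi (theta n) : R[i]^o) =
    (fun n => (c n * cos (theta n)) +i* (c n * sin (theta n)) : R[i]^o).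
  apply/funext => n; apply/eqP; rewrite eq_complex /=.
  by rewrite !mul0r subr0 addr0 !eqxx.
rewrite series_complexE; apply/cvg_ex.
have /sub/cvg_ex[a ca] : forall n, `|cos (theta n)| <= 1.
  by move=> n; rewrite ler_norml cos_geN1 cos_le1.
have /sub/cvg_ex[b cb] : forall n, `|sin (theta n)| <= 1.
  by move=> n; rewrite ler_norml sin_geN1 sin_le1.
by exists (a +i* b : R[i]^o); exact: cvg_complex.
Qed.

Lemma norm_limn_le (u : nat -> R[i]^o) (B : R) : cvgn u ->
  (\forall n \near \oo, `|u n| <= B%:C) -> `|limn u| <= B%:C.
Proof.
move=> cu uB; set l := limn u.
have normE (z : R[i]) : `|z| = (complex.Re `|z|)%:C by rewrite normc_def.
rewrite normE lecR; apply/ler_addgt0Pr => e e0; rewrite -lecR -normE rmorphD /=.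
have /cvgrPdist_lt/(_ e%:C) : u @ \oo --> l by exact: cu.
rewrite ltcR => /(_ e0) ue; near \oo => n.
have -> : l = u n + (l - u n) by rewrite addrC subrK.
apply: (le_trans (ler_normD _ _)); apply: lerD; first by near: n.
by apply: ltW; near: n.
Unshelve. all: by end_near. Qed.

End ComplexSeries.

(** * Sums over a fine lattice *)

Section LatticeSums.
Context {R : realType}.
Implicit Types (w chi : R -> R) (s a x : R).

Lemma cvg_series_sampling w s a : (forall x, 0 <= w x) -> quad_decay 0 w ->
  0 < s <= 1 -> cvgn (series (fun n => w (a + n%:R * s))).
Proof.
move=> w0 /quad_decay_bound[C C0 wC] s01.
apply: nondecreasing_is_cvgn.
  by apply: nondecreasing_series => n _ _; exact: w0.
exists (C * (3 * pi / s)) => _ [J _ <-]; rewrite /series /= big_mkord.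
apply: (@le_trans _ _ (C * \sum_(n < J) lorentz (a + n%:R * s))).
  by rewrite mulr_sumr; apply: ler_sum => n _; rewrite (le_trans (ler_norm _)).
by rewrite ler_wpM2l// sum_lorentz.
Qed.

Lemma le_limn_series (u : nat -> R) n : (forall m, 0 <= u m) ->
  cvgn (series u) -> u n <= limn (series u).
Proof.
move=> u0 cu; apply: le_trans (nondecreasing_cvgn_le _ cu n.+1).
  by rewrite /series /= big_nat_recr//= lerDr sumr_ge0.
by apply: nondecreasing_series => m _ _; exact: u0.
Qed.

(** Keeps the normalizing constant bounded. By continuity [chi] exceeds half of a
    positive value [chi x0] within [r] of [x0], and a lattice of step less than
    [r] has a point there, just to the right of [x0]. By evenness [x0] can be
    taken nonnegative, so that this point has an index not less than [n0] and
    lies in the range of summation. *)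
Lemma sample_ge chi : continuous chi -> (exists x, chi x != 0) ->
    (forall x, 0 <= chi x) -> (forall x, chi (- x) = chi x) ->
  exists2 c, 0 < c & exists2 r, 0 < r & forall s (n0 : nat), 0 < s < r ->
    exists n : nat, c <= chi (- (n0%:R * s) + n%:R * s) ^+ 2.
Proof.
move=> chic [x0' chi0] chi_ge0 chi_even.
have {chi0} : chi `|x0'| != 0.
  by have [//|_] := ger0P x0'; rewrite chi_even.
move: `|x0'| (normr_ge0 x0') => {x0'} x0 x0_ge0 chi0.
have {}chi0 : 0 < chi x0 by rewrite lt_neqAle eq_sym chi0 chi_ge0.
exists ((chi x0 / 2) ^+ 2); first by rewrite exprn_gt0 ?divr_gt0.
have /cvgrPdist_lt/(_ (chi x0 / 2)) := chic x0.
rewrite divr_gt0// => /(_ isT)/nbhs_ballP[r /= r0 chir].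
exists r => // s n0 /andP[s0 sr].
pose k := (Num.truncn (x0 / s)).+1.
have /truncn_itv/andP[k1 k2] : 0 <= x0 / s by rewrite divr_ge0// ltW.
exists (n0 + k)%N; rewrite natrD mulrDl addKr.
move: k1 k2; rewrite ler_pdivlMr// ltr_pdivrMr// => k1 k2.
have /chir : ball x0 r (k%:R * s).
  rewrite /ball /= ltr_norml; move: k1 k2; rewrite /k -natr1; lra.
rewrite ltr_norml => /andP[_ chik].
by rewrite ler_sqr ?nnegrE ?divr_ge0 ?chi_ge0//; lra.
Qed.

Lemma iter_delta_sampling (j : nat) w s a n :
  iter j delta (fun m => (w (a + m%:R * s))%:C) n =
  (iter j (fdiff s) w (a + n%:R * s))%:C.
Proof.
elim: j n => [//|j IH] n; rewrite /= /delta !IH -rmorphB /= /fdiff.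
by rewrite -natr1 mulrDl mul1r addrA.
Qed.

(** Non-stationary phase for the sampled profile. After [k] summations by
    parts the interior contributes [(s / dist) ^ k] times [1 / s], the number of
    samples that matter. The boundary terms at [0] have size
    [C * lorentz (n0 s) / dist], since [s <= dist] absorbs the higher powers, and
    those at [J] are no larger once [J >= 2 n0], because [J - n0 >= n0]. *)
Lemma trigonometric_sum_le k w : quad_decay k w ->
  exists2 C, 0 <= C & forall s x (n0 : nat), 0 < s <= 1 -> s <= dist_int x ->
    \forall J \near \oo,
    `|\sum_(n < J) (w (- (n0%:R * s) + n%:R * s))%:C * expi (- (2 * pi * x)) ^+ n|
    <= (C / s * (lorentz (n0%:R * s) + (s / dist_int x) ^+ k))%:C.
Proof.
move=> wk; have [C C0 wC] := iter_fdiff_le_uniform wk.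
have pi0 := pi_gt0 R.
exists (C * (3 * pi + 2 * k%:R)); first by rewrite mulr_ge0// addr_ge0// mulr_ge0// ltW.
move=> s x n0 /[dup] s01 /andP[s0 s1]; set d := dist_int x => sd.
have d0 : 0 < d by exact: lt_le_trans sd.
exists (2 * n0)%N => // J /= n0J.
set a := - (n0%:R * s); set z := expi _; pose u n := (w (a + n%:R * s))%:C.
have dz : d%:C <= `|1 - z| by exact: dist_int_le_chord.
have dz0 : 0 < `|1 - z| by apply: lt_le_trans dz; rewrite ltcR.
have z1 : z != 1 by move: dz0; rewrite normr_gt0 subr_eq0 eq_sym.
apply: le_trans (iter_summation_by_parts k u J (norm_expi _) z1) _.
have inv_le j (v : R) : 0 <= v -> v%:C / `|1 - z| ^+ j <= (v / d ^+ j)%:C.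
  move=> v0; rewrite rmorphM fmorphV rmorphXn /= ler_wpM2l ?ler0c//.
  have d0c : 0 < d%:C by rewrite ltcR.
  by rewrite lef_pV2 ?posrE ?exprn_gt0//; apply: lerXn2r; rewrite ?nnegrE// ltW.
have normR (y : R) : `|y%:C| = `|y|%:C :> R[i].
  by rewrite normc_def /= expr0n addr0 sqrtr_sqr.
have lza : lorentz a = lorentz (n0%:R * s) by rewrite /lorentz sqrrN.
have lzJ : lorentz (a + J%:R * s) <= lorentz (n0%:R * s).
  have : 2 * n0%:R <= J%:R :> R by rewrite -natrM ler_nat.
  rewrite -(ler_pM2r s0) => ?; have : 0 <= n0%:R * s by rewrite mulr_ge0// ltW.
  by move=> ?; apply: lorentz_le_far; rewrite /a; nra.
have bnd j : (j < k)%N ->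
    (`|iter j delta u 0%N| + `|iter j delta u J|) / `|1 - z| ^+ j.+1 <=
    (2 * C / s * lorentz (n0%:R * s))%:C.
  move=> jk; rewrite /u !iter_delta_sampling !normR -rmorphD /=.
  apply: le_trans (inv_le _ _ _) _; first exact: addr_ge0.
  rewrite lecR ler_pdivrMr ?exprn_gt0//.
  have := wC j s (a + 0%:R * s) (ltnW jk) s01; rewrite mul0r addr0 lza => h0.
  have := wC j s (a + J%:R * s) (ltnW jk) s01 => hJ.
  have Cs : 0 <= C * s ^+ j by rewrite mulr_ge0 ?exprn_ge0 ?(ltW s0).
  have := ler_wpM2l Cs lzJ => lzJ'.
  have -> : 2 * C / s * lorentz (n0%:R * s) * d ^+ j.+1 =
    2 * (C * lorentz (n0%:R * s)) * (d ^+ j * (d / s)) by rewrite exprSr; field; rewrite gt_eqF.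
  have : s ^+ j <= d ^+ j * (d / s).
    rewrite -[leLHS]mulr1 ler_pM ?exprn_ge0 ?(ltW s0)//.
      by apply: lerXn2r; rewrite ?nnegrE ?(ltW s0) ?(ltW d0).
    by rewrite ler_pdivlMr// mul1r.
  have Cl : 0 <= C * lorentz (n0%:R * s) by rewrite mulr_ge0// ltW// lorentz_gt0.
  move=> /(ler_wpM2l Cl); lra.
have tail : (\sum_(n < J) `|iter k delta u n|) / `|1 - z| ^+ k <=
    (C * (3 * pi) / s * (s / d) ^+ k)%:C.
  have -> : \sum_(n < J) `|iter k delta u n| =
      (\sum_(n < J) `|iter k (fdiff s) w (a + n%:R * s)|)%:C.
    by rewrite rmorph_sum /=; apply: eq_bigr => n _; rewrite /u iter_delta_sampling normR.
  apply: le_trans (inv_le _ _ _) _; first exact: sumr_ge0.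
  rewrite lecR expr_div_n mulrA ler_wpM2r ?invr_ge0 ?exprn_ge0 ?(ltW d0)//.
  apply: (@le_trans _ _ (C * s ^+ k * \sum_(n < J) lorentz (a + n%:R * s))).
    by rewrite mulr_sumr; apply: ler_sum => n _; exact: wC.
  have -> : C * (3 * pi) / s * s ^+ k = C * s ^+ k * (3 * pi / s) by ring.
  by rewrite ler_wpM2l ?sum_lorentz// mulr_ge0 ?exprn_ge0 ?(ltW s0).
apply: le_trans (lerD (ler_sum _ (fun j _ => bnd _ (ltn_ord j))) tail) _.
rewrite sumr_const card_ord -rmorphMn -rmorphD /= lecR -mulr_natl.
set l := lorentz _; set e := (s / d) ^+ k.
have l0 : 0 < l by exact: lorentz_gt0.
have e0 : 0 < e by rewrite exprn_gt0// divr_gt0.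
have Cs0 : 0 <= C / s by rewrite divr_ge0// ltW.
rewrite -subr_ge0.
have -> : C * (3 * pi + 2 * k%:R) / s * (l + e) -
  (k%:R * (2 * C / s * l) + C * (3 * pi) / s * e) =
  C / s * (3 * pi * l + 2 * k%:R * e) by ring.
by rewrite mulr_ge0// addr_ge0// !mulr_ge0// ltW.
Qed.

End LatticeSums.

(** * The wave packet *)

Section WavePacket.
Context {R : realType}.
Variables (chi : R -> R) (gamma' h : R) (m : nat).
Hypothesis hchi : schwartz chi.

Let width : R := `|ln h| `^ (1 - gamma').
Hypothesis width_ge1 : 1 <= width.

Let sample (n : nat) : R := - (m%:R * width^-1) + n%:R * width^-1.
Let mass : R := limn (series (fun n => chi (sample n) ^+ 2)).
Hypothesis mass_gt0 : 0 < mass.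

Lemma profile_sample n : profile chi gamma' h m n%:Z = chi (sample n).
Proof. by rewrite /profile intrB mulrBl addrC. Qed.

(** Writes the squared coefficients with [mass], in which the square root and
    the inverse of the normalizing constant have disappeared. *)
Lemma coef_sqr n : `|coef chi gamma' h m n%:Z| ^+ 2 = mass^-1 * chi (sample n) ^+ 2.
Proof.
have profileE : (fun j : nat => `|profile chi gamma' h m j%:Z| ^+ 2) =
    (fun j => chi (sample j) ^+ 2).
  by apply/funext => j; rewrite profile_sample real_normK ?num_real.
rewrite real_normK ?num_real// /coef exprMn profile_sample; congr (_ * _).
rewrite /K_norm /l2_norm exprVn sqr_sqrtr.
  by rewrite profileE.
by rewrite profileE; exact: ltW.
Qed.

Lemma widthV01 : 0 < width^-1 <= 1.
Proof. by rewrite invr_gt0 invf_le1 ?width_ge1 ?(lt_le_trans ltr01). Qed.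

Lemma quad_decay_sqr k : quad_decay k (fun x => chi x ^+ 2).
Proof. by apply: quad_decayM; exact: schwartz_quad_decay. Qed.

Lemma cvg_mass : cvgn (series (fun n => chi (sample n) ^+ 2)).
Proof.
apply: (@cvg_series_sampling _ (fun x => chi x ^+ 2) _ _ _ (quad_decay_sqr 0) widthV01).
by move=> x; exact: sqr_ge0.
Qed.

(** At a multiple of [T] every phase is a multiple of [2 pi], and what is left
    is the sum of the squared coefficients. *)
Lemma autocorr_recurrence T (l : int) :
  series (autocorr_term chi gamma' h m T (T * l%:~R)) @ \oo --> (1 : R[i]^o).
Proof.
have phase1 n : expi (- (T * l%:~R * (2 * pi * (n%:Z - m%:Z)%:~R / T))) = 1.
  (* For T = 0 both the time and 1 / T = 0 vanish, so the phase is still 1. *)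
  have [->|T0] := eqVneq T 0; first by rewrite !mul0r oppr0 expi0.
  rewrite -[RHS](@expi_2piz R (- (l * (n%:Z - m%:Z)))); congr expi.
  by rewrite mulrNz intrM; field.
have -> : autocorr_term chi gamma' h m T (T * l%:~R) =
    (fun n => (mass^-1 * chi (sample n) ^+ 2) +i* 0 : R[i]^o).
  by apply/funext => n; rewrite /autocorr_term phase1 mulr1 coef_sqr.
rewrite series_complexE; apply: cvg_complex; last first.
  by rewrite /series /=; under eq_fun do rewrite big1//; exact: cvg_cst.
have -> : series (fun n => mass^-1 * chi (sample n) ^+ 2) =
    (fun J => mass^-1 * series (fun n => chi (sample n) ^+ 2) J).
  by apply/funext => J; rewrite /series /= mulr_sumr.
rewrite -[1](@mulVf _ mass) ?gt_eqF//.
by apply: cvgM; [exact: cvg_cst|exact: cvg_mass].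
Qed.

(** Separates the constant phase that comes from centring at [m], which does not
    affect the modulus, from a geometric sequence. *)
Lemma autocorr_termE T t n :
  autocorr_term chi gamma' h m T t n =
  (mass^-1)%:C * expi (m%:R * (2 * pi * (t / T))) *
  ((chi (sample n) ^+ 2)%:C * expi (- (2 * pi * (t / T))) ^+ n).
Proof.
rewrite /autocorr_term coef_sqr rmorphM /= -expiMn.
have -> : - (t * (2 * pi * (n%:Z - m%:Z)%:~R / T)) =
   m%:R * (2 * pi * (t / T)) + n%:R * - (2 * pi * (t / T)).
  by rewrite intrB; ring.
by rewrite expiD; ring.
Qed.

Lemma cvg_autocorr T t : cvgn (series (autocorr_term chi gamma' h m T t)).
Proof.
apply: cvg_series_expi.
have -> : (fun n => `| `|coef chi gamma' h m n%:Z| ^+ 2|) =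
    (fun n => mass^-1 * chi (sample n) ^+ 2).
  by apply/funext => n; rewrite ger0_norm ?sqr_ge0// coef_sqr.
by apply: is_cvg_seriesZ; exact: cvg_mass.
Qed.

Lemma norm_autocorr_le (C : R) T t :
  (\forall J \near \oo,
    `|\sum_(n < J) (chi (sample n) ^+ 2)%:C * expi (- (2 * pi * (t / T))) ^+ n|
    <= C%:C) ->
  `|limn (series (autocorr_term chi gamma' h m T t))| <= (C / mass)%:C.
Proof.
move=> bound; apply: norm_limn_le; first exact: cvg_autocorr.
apply: filterS bound => J boundJ.
have -> : series (autocorr_term chi gamma' h m T t) J =
    (mass^-1)%:C * expi (m%:R * (2 * pi * (t / T))) *
    \sum_(n < J) (chi (sample n) ^+ 2)%:C * expi (- (2 * pi * (t / T))) ^+ n.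
  by rewrite /series /= big_mkord mulr_sumr; apply: eq_bigr => n _;
     exact: autocorr_termE.
have massV0 : 0 <= (mass^-1)%:C by rewrite ler0c invr_ge0 ltW.
by rewrite !normrM norm_expi mulr1 ger0_norm// mulrC rmorphM /= ler_wpM2r.
Qed.

End WavePacket.

(** * Asymptotics in the semiclassical parameter *)

Section SemiclassicalLimit.
Context {R : realType}.

Lemma near_lnN (B : R) : \forall h \near 0^'+, B < - ln h.
Proof.
near=> h; have h0 : 0 < h by near: h; exact: nbhs_right_gt.
rewrite ltrNr -ltr_expR lnK ?posrE//.
by near: h; apply: nbhs_right_lt; exact: expR_gt0.
Unshelve. all: by end_near. Qed.

Lemma near_equiv_ge (n0 : R -> int) (N : R) : 0 < N ->
  (fun h => (n0 h)%:~R) ~_(0^'+) (fun h => N / h) ->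
  \forall h \near 0^'+, N / (2 * h) <= (n0 h)%:~R.
Proof.
move=> N0 /eqaddoP/(_ 2^-1); rewrite invr_gt0 ltr0n => /(_ isT) near0.
near=> h; have h0 : 0 < h by near: h; exact: nbhs_right_gt.
have : `|(n0 h)%:~R - N / h| <= 2^-1 * `|N / h| by near: h.
have Nh : 0 < N / h by rewrite divr_gt0.
rewrite (gtr0_norm Nh) ler_norml => /andP[+ _].
have -> : N / (2 * h) = N / h / 2 by rewrite invfM mulrCA mulrC.
lra.
Unshelve. all: by end_near. Qed.

(** Powers of the logarithm are negligible against powers of [h], because
    [expR A] dominates [A ^ n / n!]. *)
Lemma expr_norm_ln_le (h : R) n : 0 < h -> 0 <= - ln h ->
  `|ln h| ^+ n.+1 * h <= n.+1`!%:R.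
Proof.
move=> h0 A0; have {2}<- : expR (- - ln h) = h by rewrite opprK lnK.
rewrite -normrN ger0_norm//; move: (- ln h) A0 => A A0.
have f0 : 0 < n.+1`!%:R :> R by rewrite ltr0n fact_gt0.
rewrite expRN ler_pdivrMr ?expR_gt0// mulrC -ler_pdivrMr//.
by apply: le_trans (expR_ge1Dxn n A0); rewrite lerDr.
Qed.

Lemma near_width_ge (p B : R) : 0 < p ->
  \forall h \near 0^'+, B <= `|ln h| `^ p.
Proof.
move=> p0; apply: filterS (near_lnN (`|B| `^ p^-1)) => h hB.
have A0 : `|B| `^ p^-1 <= `|ln h|.
  by rewrite -(normrN (ln h)) (le_trans (ltW hB))// ler_norm.
apply: (le_trans (ler_norm B)).
have -> : `|B| = (`|B| `^ p^-1) `^ p by rewrite -powRrM mulVf ?gt_eqF// powRr1.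
by apply: ge0_ler_powR; rewrite ?nnegrE ?powR_ge0// ltW.
Qed.

End SemiclassicalLimit.

(** * Recurrence and decay of the autocorrelation *)

Theorem corollary5p12 (R : realType)
  (V : R -> R) (hV : single_barrier V)
  (delta : R) (hdelta : 0 < delta)
  (eps Sp Sm : R -> R -> R) (eps_ Sp_ Sm_ : nat -> R -> R)
  (heps : semiclassical_expansion delta eps eps_)
  (hSp : semiclassical_expansion delta Sp Sp_)
  (hSm : semiclassical_expansion delta Sm Sm_)
  (heps0 : eps_ 0%N 0 = 0)
  (heps0' : derive1 (eps_ 0%N) 0 = 1 / Num.sqrt (- derive1n 2 V 0))
  (E : R) (hE : -1 <= E <= 1)
  (n0 : R -> int) (N : R) (hN : 0 < N)
  (hn0 : (fun h => (n0 h)%:~R) ~_(0^'+) (fun h => N / h))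
  (chi : R -> R) (hchi : schwartz chi) (hchi0 : exists x, chi x != 0)
  (hchi_ge0 : forall x, 0 <= chi x) (hchi_even : forall x, chi (- x) = chi x)
  (gamma' : R) (hgamma' : 0 <= gamma' < 1) :
  (\forall h \near 0^'+, is_unique_minimizer eps Sp Sm h E (n0 h) ->
     forall t : R, (exists l : int, t = T_hyp eps Sp Sm h (n0 h) * l%:~R) ->
       series (autocorr_term chi gamma' h (n0 h)
                 (T_hyp eps Sp Sm h (n0 h)) t) @ \oo --> (1 : R[i]^o))
  /\
  (forall epsilon : R, 0 < epsilon -> epsilon < 1 - gamma' ->
   forall M : nat, (1 <= M)%N ->
   exists C : R, \forall h \near 0^'+,
     is_unique_minimizer eps Sp Sm h E (n0 h) ->
     forall t : R,
       dist_int (t / T_hyp eps Sp Sm h (n0 h))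
         > `|ln h| `^ (gamma' - 1 + epsilon) ->
       let s := series (autocorr_term chi gamma' h (n0 h)
                          (T_hyp eps Sp Sm h (n0 h)) t) in
       cvgn s /\ `|limn s| <= (C * `|ln h| ^- M)%:C).
Proof.
have [g0 g1] := andP hgamma'; have p0 : 0 < 1 - gamma' by rewrite subr_gt0.
have chic : continuous chi.
  move=> x; apply/differentiable_continuous/derivable1_diffP.
  exact: (hchi.1 0%N).
have [c c0 [r r0 sampler]] := sample_ge chic hchi0 hchi_ge0 hchi_even.
pose width h : R := `|ln h| `^ (1 - gamma').
pose mass h : R := limn (series (fun n =>
  chi (- ((`|n0 h|%N)%:R * (width h)^-1) + n%:R * (width h)^-1) ^+ 2)).
have good : \forall h \near 0^'+, [/\ 0 < h < 1, 1 <= width h,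
    N / (2 * h) <= (`|n0 h|%N)%:R, n0 h = (`|n0 h|%N)%:Z &
    1 <= `|ln h| /\ c <= mass h].
  near=> h; have h0 : 0 < h by near: h; exact: nbhs_right_gt.
  have h1 : h < 1 by near: h; exact: nbhs_right_lt.
  have A1 : 1 <= `|ln h|.
    have lnh : 1 < - ln h by near: h; exact: near_lnN.
    by rewrite -normrN (le_trans (ltW lnh))// ler_norm.
  have L1 : 1 <= width h by near: h; exact: near_width_ge.
  have Lr : 2 / r <= width h by near: h; exact: near_width_ge.
  have n0N : N / (2 * h) <= (n0 h)%:~R by near: h; exact: near_equiv_ge.
  have n0E : n0 h = (`|n0 h|%N)%:Z.
    rewrite gez0_abs// -(ler0z R) (le_trans _ n0N)// divr_ge0 ?(ltW hN)//.
    by rewrite mulr_ge0// ltW.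
  have L0 : 0 < width h by exact: lt_le_trans L1.
  split => //; [by rewrite h0|by rewrite {1}n0E in n0N|].
  split => //.
  have [|n cn] := sampler (width h)^-1 `|n0 h|%N.
    rewrite invr_gt0 L0 /= -[ltRHS]invrK ltf_pV2 ?posrE ?invr_gt0//.
    by apply: lt_le_trans Lr; rewrite ltr_pMl ?invr_gt0// ltr1n.
  apply: (le_trans cn); apply: (@le_limn_series _ (fun n => chi _ ^+ 2)).
    by move=> j; exact: sqr_ge0.
  exact: cvg_mass.
split.
  near=> h; move=> _ t [l ->].
  have [/andP[h0 h1] L1 _ n0E [_ cm]] : [/\ 0 < h < 1, 1 <= width h,
    N / (2 * h) <= (`|n0 h|%N)%:R, n0 h = (`|n0 h|%N)%:Z &
    1 <= `|ln h| /\ c <= mass h] by near: h; exact: good.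
  rewrite n0E; apply: autocorr_recurrence => //.
  exact: lt_le_trans cm.
move=> e e0 e1 M M1.
(* The order of summation by parts: each one gains [|ln h| ^ - e], and one more
   power of [|ln h|] pays for the width of the packet. *)
pose k := (Num.truncn ((M.+1)%:R / e)).+1.
have ke : M.+1%:R <= e * k%:R.
  have /truncn_itv/andP[_] : 0 <= M.+1%:R / e by rewrite divr_ge0// ltW.
  by rewrite ltr_pdivrMr// mulrC => /ltW.
have [C C0 sum_le] := trigonometric_sum_le (quad_decay_sqr hchi k).
(* The factorial comes from the boundary term, of size
   [|ln h| ^ 3 h ^ 2 <= (M + 3)! |ln h| ^ - M] up to a constant. *)
exists (C / c * (4 * (M.+3)`!%:R / N ^+ 2 + 1)).
near=> h; move=> _ t dist_t.
have [/andP[h0 h1] L1 n0N n0E [A1 cm]] : [/\ 0 < h < 1, 1 <= width h,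
    N / (2 * h) <= (`|n0 h|%N)%:R, n0 h = (`|n0 h|%N)%:Z &
    1 <= `|ln h| /\ c <= mass h] by near: h; exact: good.
move: dist_t; rewrite n0E; set m := `|n0 h|%N in n0N cm *.
set T := T_hyp _ _ _ _ _.
move=> dist_t /=.
set d := dist_int (t / T) in dist_t.
set A := `|ln h| in A1 dist_t *; set L := width h in L1 cm *.
have A0 : 0 < A by exact: lt_le_trans A1.
have L0 : 0 < L by exact: lt_le_trans L1.
have Ld : L^-1 * A `^ e < d.
  apply: le_lt_trans dist_t; rewrite /L /width -/A -powRN.
  rewrite -powRD; first by rewrite opprB.
  by apply/implyP => _; rewrite gt_eqF.
have Ae0 : 0 < A `^ e by exact: powR_gt0.
have Ae1 : 1 <= A `^ e by rewrite -(powRr0 A) ler_powR// ltW.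
have sd : L^-1 <= d.
  by rewrite (le_trans _ (ltW Ld))// ler_peMr// invr_ge0 ltW.
have d0 : 0 < d by apply: lt_le_trans sd; rewrite invr_gt0.
have m0 : 0 < mass h by exact: lt_le_trans cm.
split; first exact: cvg_autocorr.
apply: le_trans (norm_autocorr_le hchi L1 m0 (sum_le _ (t / T) m (widthV01 L1) sd)) _.
rewrite lecR invrK -/d.
have LA : L <= A by rewrite -[leRHS](powRr1 (ltW A0)) ler_powR// lerBlDr lerDl.
(* The index 0 is far out in the tail of the packet: m ~ N / h, L <= |ln h|. *)
have lor : lorentz (m%:R * L^-1) <= A ^+ 2 * (2 * h / N) ^+ 2.
  have mN : 0 < N / (2 * h) by rewrite divr_gt0// mulr_gt0.
  have m0' : 0 < m%:R :> R by exact: lt_le_trans n0N.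
  have mL : 0 < m%:R * L^-1 by rewrite mulr_gt0// invr_gt0.
  apply: le_trans (lorentz_le_sqrV (negbT (gt_eqF mL))) _.
  rewrite -exprVn invfM invrK mulrC -exprMn.
  apply: lerXn2r; rewrite ?nnegrE ?mulr_ge0 ?invr_ge0 ?(ltW A0) ?(ltW L0)
    ?(ltW m0') ?(ltW hN) ?(ltW h0)//.
  apply: ler_pM; rewrite ?invr_ge0 ?(ltW L0) ?(ltW m0')//.
  by rewrite -[leRHS]invf_div lef_pV2 ?posrE.
(* The frequency t / T stays at distance more than [|ln h| ^ e / L] from the
   integers. *)
have osc : (L^-1 / d) ^+ k <= A ^- M.+1.
  have sdA : L^-1 / d <= (A `^ e)^-1.
    by rewrite ler_pdivrMr// mulrC ler_pdivlMr// ltW.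
  apply: (@le_trans _ _ ((A `^ e)^-1 ^+ k)).
    by apply: lerXn2r; rewrite ?nnegrE ?divr_ge0 ?invr_ge0 ?(ltW Ae0) ?(ltW d0) ?(ltW L0).
  rewrite exprVn lef_pV2 ?posrE ?exprn_gt0//.
  by rewrite -!powR_mulrn ?(ltW A0) ?(ltW Ae0)// -powRrM ler_powR.
have AM0 : 0 < A ^+ M by rewrite exprn_gt0.
have main : A * (A ^+ 2 * (2 * h / N) ^+ 2 + A ^- M.+1) <=
    (4 * M.+3`!%:R / N ^+ 2 + 1) * A ^- M.
  have -> : A * (A ^+ 2 * (2 * h / N) ^+ 2 + A ^- M.+1) =
      (4 * (A ^+ M.+3 * h * h) / N ^+ 2 + 1) * A ^- M.
    by rewrite !exprS; field; rewrite !gt_eqF.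
  rewrite ler_pM2r ?invr_gt0// lerD2r ler_pM2r ?invr_gt0 ?exprn_gt0// ler_pM2l//.
  have Ah : A ^+ M.+3 * h <= M.+3`!%:R.
    by apply: expr_norm_ln_le => //; rewrite oppr_ge0 ln_le0// ltW.
  apply: (@le_trans _ _ (A ^+ M.+3 * h)) => //.
  by rewrite ler_piMr ?(ltW h1)// mulr_ge0 ?exprn_ge0 ?(ltW A0) ?(ltW h0).
have err0 : 0 <= lorentz (m%:R * L^-1) + (L^-1 / d) ^+ k.
  rewrite addr_ge0 ?(ltW (lorentz_gt0 _))// exprn_ge0//.
  by rewrite divr_ge0 ?invr_ge0 ?(ltW L0) ?(ltW d0).
have total : L * (lorentz (m%:R * L^-1) + (L^-1 / d) ^+ k) <=
    (4 * M.+3`!%:R / N ^+ 2 + 1) * A ^- M.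
  by apply: le_trans main; apply: ler_pM; rewrite ?(ltW L0) ?lerD.
have -> : C / c * (4 * M.+3`!%:R / N ^+ 2 + 1) / A ^+ M =
    C * ((4 * M.+3`!%:R / N ^+ 2 + 1) * A ^- M) / c by ring.
have K0 : 0 <= (4 * M.+3`!%:R / N ^+ 2 + 1) * A ^- M.
  apply: mulr_ge0; last by rewrite invr_ge0 ltW.
  apply: addr_ge0 => //; apply: divr_ge0; last exact: sqr_ge0.
  by rewrite mulr_ge0 ?ler0n.
rewrite -(mulrA C); apply: ler_pM; rewrite ?invr_ge0 ?(ltW m0)//.
- by rewrite mulr_ge0// mulr_ge0 ?(ltW L0).
- by rewrite ler_wpM2l.
- by rewrite lef_pV2 ?posrE.
Unshelve. all: by end_near. Qed.
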